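(* Let $(G,N,\theta)_{\mathcal H}$ and $(H,M,\varphi)_{\mathcal H}$ be $\mathcal H$-triples with $(G,N,\theta)_{\mathcal H}\ge_c(H,M,\varphi)_{\mathcal H}$. Let $k,m$ be positive integers, let $\sigma_1,\dots,\sigma_k\in\mathcal H$, and write $\theta_i=\theta^{\sigma_i}$ and $\varphi_i=\varphi^{\sigma_i}$. Suppose that $\theta_i$ and $\theta_j$ are not $G$-conjugate whenever $i\neq j$. Then, with $n=mk$, $\tilde\theta=\theta_1^m\times\cdots\times\theta_k^m\in\mathrm{Irr}(N^n)$ and $\tilde\varphi=\varphi_1^m\times\cdots\times\varphi_k^m\in\mathrm{Irr}(M^n)$, $$((G\wr\mathsf S_n)_{\tilde\theta^{\mathcal H}},N^n,\tilde\theta)_{\mathcal H}\ge_c((H\wr\mathsf S_n)_{\tilde\varphi^{\mathcal H}},M^n,\tilde\varphi)_{\mathcal H}.$$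
   Context: All groups are finite; $p$ is a fixed prime. $\mathbb Q^{\mathrm{ab}}\subseteq\mathbb C$ is generated by all roots of unity, $\mathcal G=\mathrm{Gal}(\mathbb Q^{\mathrm{ab}}/\mathbb Q)$, and $\mathcal H\le\mathcal G$ consists of those $\sigma$ for which there is an integer $f$ with $\sigma(\xi)=\xi^{p^f}$ for all roots of unity $\xi$ of order prime to $p$. For $N\trianglelefteq G$, $\theta\in\mathrm{Irr}(N)$, $g\in G$, $\sigma\in\mathcal G$: $\theta^{g\sigma}(n)=\sigma(\theta(gng^{-1}))$; $A_\theta$ is the stabilizer in $A\le G\times\mathcal G$; $\theta^{\mathcal H}$ the $\mathcal H$-orbit; $G_{\theta^{\mathcal H}}=\{g:\theta^g\in\theta^{\mathcal H}\}$. $(G,N,\theta)_{\mathcal H}$ is an $\mathcal H$-triple if $N\trianglelefteq G$, $\theta\in\mathrm{Irr}(N)$, $G_{\theta^{\mathcal H}}=G$. $G^n$ is the $n$-fold direct product, $\theta^m=\theta\times\cdots\times\theta$; $\mathsf S_n$ acts on $G^n$ by $(g_1,\dots,g_n)^\omega=(g_{\omega^{-1}(1)},\dots,g_{\omega^{-1}(n)})$ and $G\wr\mathsf S_n=G^n\rtimes\mathsf S_n$, in which $N^n$ is normal. Projective representation $\mathcal P$ with factor set $\alpha$: $\mathcal P(x)\mathcal P(y)=\alpha(x,y)\mathcal P(xy)$. For $G$-invariant $\theta$, $\mathcal P$ is associated with $\theta$ if $\mathcal P_N$ affords $\theta$ and $\mathcal P(ng)=\mathcal P(n)\mathcal P(g)$,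 $\mathcal P(gn)=\mathcal P(g)\mathcal P(n)$. $\mathcal Q\sim\mu\mathcal P$ means $\mathcal Q(x)=\mu(x)M^{-1}\mathcal P(x)M$ for a fixed invertible $M$. For $\mathcal P$ associated with $\theta$ on $G_\theta$ with entries in $\mathbb Q^{\mathrm{ab}}$ and $\theta^{x\sigma}=\theta$: $\mathcal P^{x\sigma}(y)=\sigma(\mathcal P(xyx^{-1}))$, and $\mu_{x\sigma}$ is the unique function $G_\theta\to\mathbb C^\times$, constant on $N$-cosets, $\mu_{x\sigma}(1)=1$, with $\mathcal P^{x\sigma}\sim\mu_{x\sigma}\mathcal P$. $(G,N,\theta)_{\mathcal H}\ge_c(H,M,\varphi)_{\mathcal H}$ (both $\mathcal H$-triples, $H\le G$) means: (i) $G=NH$, $N\cap H=M$, $\mathbf C_G(N)\subseteq H$; (ii) $(H\times\mathcal H)_\theta=(H\times\mathcal H)_\varphi$; (iii) there are projective representations $\mathcal P$ of $G_\theta$ associated with $\theta$ and $\mathcal P'$ of $H_\varphi$ associated with $\varphi$, entries in $\mathbb Q^{\mathrm{ab}}$, factor sets with root-of-unity values agreeing on $H_\theta\times H_\theta$, and $\mathcal P(c),\mathcal P'(c)$ the same scalar for all $c\in\mathbf C_G(N)$; (iv) $\mu_a=\mu'_a$ on $H_\theta$ for all $a\in(H\times\mathcal H)_\theta$. *)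

(* Defs.v *)
From HB Require Import structures.
From Stdlib Require Import ClassicalEpsilon.
From mathcomp Require Import all_boot all_order all_algebra all_fingroup.
From mathcomp Require Import all_solvable all_field all_character.

Set Implicit Arguments.
Unset Strict Implicit.
Unset Printing Implicit Defensive.

Import GRing.Theory.
Local Open Scope ring_scope.

Definition pbool (P : Prop) : bool :=
  if excluded_middle_informative P then true else false.

(* An element sigma of Gal(Q^ab/Q) is represented by a field           *)
(* automorphism of algC (every ring endomorphism of algC is one);      *)
(* everything below only depends on its restriction to Q^ab.           *)

(* x lies in Q^ab = union of the cyclotomic fields Q(zeta_n). *)
Definition Qab (x : algC) : Prop :=
  exists (n : nat) (z : algC) (q : {poly rat}),
    (0 < n)%N /\ n.-primitive_root z /\ x = (map_poly ratr q).[z].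

Definition p'_root (p : nat) (z : algC) : Prop :=
  exists m : nat, [/\ (0 < m)%N, coprime m p & z ^+ m = 1].

(* sigma \in H : there is an integer f with sigma(xi) = xi^(p^f) for all
   roots of unity xi of order prime to p; f = e >= 0 is the first case,
   f = -e <= 0 the second one (sigma(xi) is the unique p'-root whose
   p^e-th power is xi). *)
Definition inH (p : nat) (u : {rmorphism algC -> algC}) : Prop :=
  exists e : nat,
    (forall z, p'_root p z -> u z = z ^+ (p ^ e)) \/
    (forall z, p'_root p z -> (u z) ^+ (p ^ e) = z).

Section Triples.

Variable gT : finGroupType.

Definition cfGal (N : {group gT}) (g : gT) (u : {rmorphism algC -> algC})
  (theta : 'CF(N)) : 'CF(N) := cfAut u (theta ^ g)%CF.

Definition stabHorb (p : nat) (G : {set gT}) (N : {group gT}) (theta : 'CF(N))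
  : {set gT} :=
  [set g in G | pbool (exists u, inH p u /\ (theta ^ g)%CF = cfAut u theta)].

Definition Htriple (p : nat) (G : {set gT}) (N : {group gT}) (theta : 'CF(N))
  : Prop :=
  [/\ (N <| G)%g, theta \in irr N & stabHorb p G theta = G].

Definition proj_assoc (S : {set gT}) (N : {group gT}) (theta : 'CF(N)) (d : nat)
  (P : gT -> 'M[algC]_d) (alpha : gT -> gT -> algC) : Prop :=
  [/\ (forall x, x \in S -> P x \in unitmx),
      (forall x y, x \in S -> y \in S -> P x *m P y = alpha x y *: P (x * y)%g),
      mx_repr N P,
      (forall n, n \in N -> \tr (P n) = theta n) &
      (forall n g, n \in N -> g \in S ->
          P (n * g)%g = P n *m P g /\ P (g * n)%g = P g *m P n)].

Definition entries_Qab (S : {set gT}) (d : nat) (P : gT -> 'M[algC]_d) : Prop :=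
  forall x, x \in S -> forall i j, Qab (P x i j).

Definition root_factor_set (S : {set gT}) (alpha : gT -> gT -> algC) : Prop :=
  forall x y, x \in S -> y \in S -> exists e : nat, (0 < e)%N /\ alpha x y ^+ e = 1.

Definition mu_spec (S N : {set gT}) (d : nat) (P : gT -> 'M[algC]_d)
  (x : gT) (u : {rmorphism algC -> algC}) (mu : gT -> algC) : Prop :=
  [/\ mu 1%g = 1,
      (forall y, y \in S -> mu y != 0),
      (forall y n, y \in S -> n \in N -> mu (y * n)%g = mu y) &
      exists2 A : 'M[algC]_d, A \in unitmx &
        forall y, y \in S ->
          map_mx u (P (x * y * x^-1)%g) = mu y *: (invmx A *m P y *m A)].

Definition ge_c (p : nat) (G : {set gT}) (N : {group gT}) (theta : 'CF(N))
  (H : {set gT}) (M : {group gT}) (phi : 'CF(M)) : Prop :=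
  [/\ Htriple p G theta /\ Htriple p H phi, H \subset G,
  [/\ G = (N * H)%g, N :&: H = M :> {set gT} & 'C_G(N)%g \subset H],
  (forall h u, h \in H -> inH p u ->
      (cfGal h u theta = theta <-> cfGal h u phi = phi)) &
  exists (d d' : nat) (P : gT -> 'M[algC]_d) (P' : gT -> 'M[algC]_d')
         (alpha alpha' : gT -> gT -> algC),
    [/\ proj_assoc ('I_G[theta])%g theta P alpha /\
        proj_assoc ('I_H[phi])%g phi P' alpha',
        (entries_Qab ('I_G[theta])%g P /\ entries_Qab ('I_H[phi])%g P') /\
        (root_factor_set ('I_G[theta])%g alpha /\ root_factor_set ('I_H[phi])%g alpha'),
        (forall x y, x \in 'I_H[theta]%g -> y \in 'I_H[theta]%g ->
            alpha x y = alpha' x y),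
        (forall c, c \in 'C_G(N)%g -> exists lam : algC,
            P c = lam%:M /\ P' c = lam%:M) &
        (forall x u, x \in H -> inH p u -> cfGal x u theta = theta ->
          forall mu mu',
            mu_spec ('I_G[theta])%g N P x u mu ->
            mu_spec ('I_H[phi])%g M P' x u mu' ->
            forall y, y \in 'I_H[theta]%g -> mu y = mu' y)]].

End Triples.

(* Elements are pairs (f, w) standing for the product f * w in         *)
(* G^n >< S_n, with (f * w) * (f' * w') = (f * f'^(w^-1)) * (w * w'),  *)
(* where (f^w)_i = f_(w^-1 i)  (mathcomp composes permutations left to *)
(* right, so this is the paper's right action).                        *)

Section Wreath.

Variables (gT : finGroupType) (n : nat).

Definition wreath_type := ({ffun 'I_n -> gT} * {perm 'I_n})%type.
HB.instance Definition _ := Finite.on wreath_type.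

Definition wr_fun (x : wreath_type) : {ffun 'I_n -> gT} := x.1.
Definition wr_perm (x : wreath_type) : {perm 'I_n} := x.2.

Definition wr_mul (x y : wreath_type) : wreath_type :=
  ([ffun i => (x.1 i * y.1 (x.2 i))%g], (x.2 * y.2)%g).
Definition wr_one : wreath_type := ([ffun => 1%g], 1%g).
Definition wr_inv (x : wreath_type) : wreath_type :=
  ([ffun i => (x.1 (x.2^-1 i))^-1%g], x.2^-1%g).

Lemma wr_mulA : associative wr_mul.
Proof.
move=> [f a] [g b] [h c]; rewrite /wr_mul /=; congr (_, _).
  by apply/ffunP=> i; rewrite !ffunE permM mulgA.
by rewrite mulgA.
Qed.

Lemma wr_mul1 : left_id wr_one wr_mul.
Proof.
move=> [f a]; rewrite /wr_mul /wr_one /=; congr (_, _).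
  by apply/ffunP=> i; rewrite !ffunE perm1 mul1g.
by rewrite mul1g.
Qed.

Lemma wr_mulV : left_inverse wr_one wr_inv wr_mul.
Proof.
move=> [f a]; rewrite /wr_mul /wr_one /wr_inv /=; congr (_, _).
  by apply/ffunP=> i; rewrite !ffunE mulVg.
by rewrite mulVg.
Qed.

HB.instance Definition _ :=
  Finite_isGroup.Build wreath_type wr_mulA wr_mul1 wr_mulV.

Definition wreath (G : {set gT}) : {set wreath_type} :=
  [set x : wreath_type | [forall i, wr_fun x i \in G]].

Definition base_set (N : {set gT}) : {set wreath_type} :=
  [set x : wreath_type | (wr_perm x == 1%g) && [forall i, wr_fun x i \in N]].

Lemma base_group_set (N : {group gT}) : group_set (base_set N).
Proof.
apply/group_setP; split.
  by rewrite inE /wr_perm /wr_fun /=; apply/andP; split=> //;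
     apply/forallP=> i; rewrite ffunE group1.
move=> [f a] [g b]; rewrite !inE /wr_perm /wr_fun /=.
case/andP=> /eqP-> /forallP fN; case/andP=> /eqP-> /forallP gN.
apply/andP; split; first by rewrite mulg1.
by apply/forallP=> i; rewrite ffunE perm1 groupM.
Qed.

Canonical base (N : {group gT}) := Group (base_group_set N).

End Wreath.

(* Main.v *)
Require Import Defs.
From mathcomp Require Import all_boot all_order all_algebra all_fingroup.
From mathcomp Require Import all_solvable all_field all_character.

Set Implicit Arguments.
Unset Strict Implicit.
Unset Printing Implicit Defensive.

Import GRing.Theory.
Local Open Scope ring_scope.

(* Let P and P' be the projective representations given for theta and phi, and
   let b(i) be the block of the coordinate i. On the stabiliser of thetat,
   whose elements (f, w) have w preserving the blocks because the theta_i are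
   not G-conjugate, the operators
     v_1 (x) ... (x) v_n |-> (x)_i sigma_b(i)(P(f_i)) v_w(i)
   on the n-th tensor power form a projective representation associated with
   thetat, and its factor set is a product of Galois conjugates of that of P;
   likewise for phit.

   An element x = (h, w) and u fix thetat iff, for all i, h_i together with
   tau_i = sigma_b(w i)^-1 u sigma_b(i) fixes theta; hence the stabilisers of
   thetat and phit correspond. By Schur's lemma, equality of mu and mu' amounts
   to the existence of intertwiners A, A' of P^(x u) with P and of P'^(x u) with
   P' whose defects on H_theta are the same scalars. Intertwiners for the wreath
   product are assembled as tensor products of the A_i of the pairs
   (h_i, tau_i), where inside one block all A_i are translates of a single one
   by values of P; the extra scalars are then values of alpha = alpha'. *)

Lemma pboolP (P : Prop) : reflect P (pbool P).
Proof.
by rewrite /pbool; case: ClassicalEpsilon.excluded_middle_informative => h;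
  constructor.
Qed.

(** * The group $\mathcal H$: closure under composition and inverses *)

Section GaloisClosure.

Variable p : nat.
Hypothesis p_pr : prime p.
Implicit Types u v : {rmorphism algC -> algC}.

Lemma p'_root_aut u z : p'_root p z -> p'_root p (u z).
Proof. by case=> m [m0 cm zm]; exists m; split; rewrite // -rmorphXn zm rmorph1. Qed.

Lemma p'_rootX z e : p'_root p z -> p'_root p (z ^+ e).
Proof. by case=> m [m0 cm zm]; exists m; split; rewrite // exprAC zm expr1n. Qed.

(** Both roots have order dividing [a * b], which is prime to [p]. So [p ^ e] has an inverse [km]
    modulo [a * b], and raising to the power [km] recovers the root. *)
Lemma p'_root_inj e y z :
  p'_root p y -> p'_root p z -> y ^+ (p ^ e) = z ^+ (p ^ e) -> y = z.
Proof.
move=> [a [a0 ca ya]] [b [b0 cb zb]] eq_yz.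
have pe0 : (0 < p ^ e)%N by rewrite expn_gt0 prime_gt0.
case: (egcdnP (a * b) pe0) => km kn Dk _; move: Dk.
have -> : gcdn (p ^ e) (a * b) = 1%N.
  by apply/eqP; rewrite -/(coprime _ _) coprimeMr !coprimeXl // coprime_sym.
move=> Dk; have key (w : algC) : w ^+ (a * b) = 1 -> (w ^+ (p ^ e)) ^+ km = w.
  by move=> w1; rewrite -exprM mulnC Dk addn1 exprS mulnC exprM w1 expr1n mulr1.
by rewrite -(key y) ?eq_yz ?key // ?[y ^+ _]exprM ?ya ?expr1n // mulnC exprM zb expr1n.
Qed.

(* Balancing the two exponents removes the case distinction on the sign of f. *)
Lemma inHP u :
  inH p u <-> exists e f, forall z, p'_root p z -> u z ^+ (p ^ e) = z ^+ (p ^ f).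
Proof.
split=> [[e [He | He]] | [e [f Hef]]].
- by exists 0%N, e => z /He->; rewrite expr1.
- by exists e, 0%N => z /He->; rewrite expr1.
have [lef | /ltnW lfe] := leqP e f.
  exists (f - e)%N; left=> z z_p'; apply: (@p'_root_inj e).
  - exact: p'_root_aut.
  - exact: p'_rootX.
  by rewrite -exprM -expnD subnK // Hef.
exists (e - f)%N; right=> z z_p'; apply: (@p'_root_inj f) => //.
  exact/p'_rootX/p'_root_aut.
by rewrite -exprM -expnD subnK // Hef.
Qed.

Lemma inH_comp u v : inH p u -> inH p v -> inH p (u \o v).
Proof.
move=> /inHP[e [f Hu]] /inHP[e' [f' Hv]]; apply/inHP.
exists (e + e')%N, (f' + f)%N => z z_p' /=.
rewrite expnD exprM Hu; last exact: p'_root_aut.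
by rewrite exprAC Hv // -exprM expnD.
Qed.

Lemma inH_inv u : inH p u -> inH p (algC_invaut u).
Proof.
move=> /inHP[e [f Hu]]; apply/inHP; exists f, e => z z_p'.
by rewrite -Hu ?algC_invautK //; apply: p'_root_aut.
Qed.

Lemma inH_id : inH p (idfun : {rmorphism algC -> algC}).
Proof. by exists 0%N; left=> z _; rewrite expr1. Qed.

End GaloisClosure.

(** * Closure properties of $\mathbb Q^{\mathrm{ab}}$ and of roots of unity *)

Lemma Qab_horner (n : nat) (z : algC) (q : {poly rat}) :
  n.-primitive_root z -> Qab (map_poly ratr q).[z].
Proof. by move=> z_prim; exists n, z, q; rewrite (prim_order_gt0 z_prim). Qed.

Lemma QabM x y : Qab x -> Qab y -> Qab (x * y).
Proof.
move=> [n [z [q [n0 [z_prim ->]]]]] [m [t [r [m0 [t_prim ->]]]]].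
have nm0 : (0 < n * m)%N by rewrite muln_gt0 n0.
(* Both [z] and [t] are powers of a primitive root of order [n * m], so the two polynomials can be
   evaluated at a single point. *)
have [w w_prim] := C_prim_root_exists nm0.
have /(prim_rootP w_prim)[a ->] : z ^+ (n * m) = 1.
  by rewrite exprM (prim_expr_order z_prim) expr1n.
have /(prim_rootP w_prim)[b ->] : t ^+ (n * m) = 1.
  by rewrite mulnC exprM (prim_expr_order t_prim) expr1n.
suffices -> : (map_poly ratr q).[w ^+ a] * (map_poly ratr r).[w ^+ b] =
    (map_poly ratr ((q \Po 'X^a) * (r \Po 'X^b))).[w] by exact: Qab_horner w_prim.
rewrite (rmorphM (map_poly ratr)) /= !map_comp_poly /= !map_polyXn.
by rewrite hornerM !horner_comp !hornerXn.
Qed.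

Lemma Qab1 : Qab 1.
Proof.
have [w w_prim] := C_prim_root_exists (ltn0Sn 0).
by have := Qab_horner 1 w_prim; rewrite rmorph1 hornerC.
Qed.

Lemma Qab_prod (I : finType) (F : I -> algC) :
  (forall i, Qab (F i)) -> Qab (\prod_i F i).
Proof. by move=> QF; apply: big_ind => //; [apply: Qab1 | apply: QabM]. Qed.

Lemma Qab_aut (u : {rmorphism algC -> algC}) x : Qab x -> Qab (u x).
Proof.
move=> [n [z [q [_ [z_prim ->]]]]].
suffices -> : u (map_poly ratr q).[z] = (map_poly ratr q).[u z].
  by apply: Qab_horner; rewrite fmorph_primitive_root; apply: z_prim.
rewrite -horner_map -map_poly_comp; congr (_.[_]).
by apply: eq_map_poly => c /=; rewrite fmorph_rat.
Qed.

Lemma root_of_unity_prod (I : finType) (F : I -> algC) :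
  (forall i, exists e, (0 < e)%N /\ F i ^+ e = 1) ->
  exists e, (0 < e)%N /\ (\prod_i F i) ^+ e = 1.
Proof.
move=> rootF; elim/big_ind: _ => //; first by exists 1%N; rewrite expr1n.
move=> x y [e [e0 xe]] [f [f0 yf]]; exists (e * f)%N; rewrite muln_gt0 e0 f0.
by split=> //; rewrite exprMn exprM xe expr1n mulnC exprM yf expr1n mul1r.
Qed.

(** * Monomial-type operators on tensor powers *)

Section WreathMatrix.

Variables (F : fieldType) (n d : nat).
Implicit Types (A B : 'I_n -> 'M[F]_d) (w v : {perm 'I_n}).

Let idx (s : 'I_#|{ffun 'I_n -> 'I_d}|) : {ffun 'I_n -> 'I_d} := enum_val s.

Let idx_bij : {on [pred _ | true], bijective idx}.
Proof. by apply: onW_bij; apply: enum_val_bij. Qed.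

(* The action of (A_1, ..., A_n; w) on the n-th tensor power of F^d, in the
   basis of pure tensors indexed by {ffun 'I_n -> 'I_d}. *)
Definition wrmx A w : 'M[F]_#|{ffun 'I_n -> 'I_d}| :=
  \matrix_(s, t) \prod_i A i (idx s i) (idx t (w i)).

Lemma eq_wrmx A B w : A =1 B -> wrmx A w = wrmx B w.
Proof.
move=> eqAB; apply/matrixP=> s t; rewrite !mxE.
by apply: eq_bigr => i _; rewrite eqAB.
Qed.

Lemma wrmxM A w B v :
  wrmx A w *m wrmx B v = wrmx (fun i => A i *m B (w i)) (w * v)%g.
Proof.
apply/matrixP=> s t; rewrite !mxE.
pose E i j := A i (idx s i) j * B (w i) j (idx t (v (w i))).
transitivity (\prod_i \sum_j E i j); last first.
  by apply: eq_bigr => i _; rewrite mxE permM.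
rewrite bigA_distr_bigA /=.
(* Distributivity gives choices of [j] indexed by [i], whereas the basis tensor between the two
   matrices is read at [w i]. *)
rewrite [RHS](reindex (fun r : {ffun 'I_n -> 'I_d} => [ffun i => r (w i)])) /=.
  rewrite [RHS](reindex (idx)) /=; last first.
    exact: idx_bij.
  apply: eq_bigr => r _; rewrite !mxE.
  rewrite [X in _ * X](reindex_perm w) /=.
  by rewrite -big_split /=; apply: eq_bigr => i _; rewrite /E ffunE.
apply: onW_bij; exists (fun r : {ffun 'I_n -> 'I_d} => [ffun i => r (w^-1%g i)]) => r;
  by apply/ffunP=> i; rewrite !ffunE ?permKV ?permK.
Qed.

Lemma wrmx_scalar (a : 'I_n -> F) : wrmx (fun i => (a i)%:M) 1 = (\prod_i a i)%:M.
Proof.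
apply/matrixP=> s t; rewrite !mxE.
have [<- | ne_st] := eqVneq s t.
  by rewrite mulr1n; apply: eq_bigr => i _; rewrite mxE perm1 eqxx.
have /existsP[i ne_i] : [exists i, idx s i != idx t i].
  apply: contraR ne_st; rewrite negb_exists => /forallP eq_st.
  by apply/eqP/enum_val_inj/ffunP=> i; apply/eqP; have := eq_st i; rewrite negbK.
by rewrite (bigD1 i) //= mxE perm1 (negPf ne_i) mul0r.
Qed.

Lemma wrmx1 : wrmx (fun=> 1%:M) 1 = 1%:M.
Proof. by rewrite wrmx_scalar big1. Qed.

Lemma wrmxZ (a : 'I_n -> F) A w :
  wrmx (fun i => a i *: A i) w = (\prod_i a i) *: wrmx A w.
Proof.
apply/matrixP=> s t; rewrite !mxE -big_split /=.
by apply: eq_bigr => i _; rewrite mxE.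
Qed.

Lemma wrmx_unit A w : (forall i, A i \in unitmx) -> wrmx A w \in unitmx.
Proof.
move=> uA; have: wrmx A w *m wrmx (fun i => invmx (A (w^-1%g i))) w^-1 = 1%:M.
  by rewrite wrmxM mulgV -wrmx1; apply: eq_wrmx => i; rewrite permK mulmxV.
by case/mulmx1_unit.
Qed.

Lemma mxtrace_wrmx A : \tr (wrmx A 1) = \prod_i \tr (A i).
Proof.
rewrite bigA_distr_bigA /= [RHS](reindex (idx)) /=; last first.
  exact: idx_bij.
by apply: eq_bigr => s _; rewrite mxE; apply: eq_bigr => i _; rewrite perm1.
Qed.

Lemma map_wrmx (u : {rmorphism F -> F}) A w :
  map_mx u (wrmx A w) = wrmx (fun i => map_mx u (A i)) w.
Proof.
apply/matrixP=> s t; rewrite !mxE rmorph_prod.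
by apply: eq_bigr => i _; rewrite mxE.
Qed.

(* For d = 1 the tensor power is one-dimensional and permutations act trivially. *)
Lemma wrmx_dim1 (a : 'I_n -> F) w :
  d = 1%N -> wrmx (fun i => (a i)%:M) w = (\prod_i a i)%:M.
Proof.
move=> d1; rewrite -wrmx_scalar; apply/matrixP=> s t; rewrite !mxE.
apply: eq_bigr => i _; congr (fun_of_matrix _ _ _).
by apply: ord_inj; case: (idx t _) => a1; case: (idx t _) => a2; rewrite /= d1;
  case: a1 a2 => [|?] [|?].
Qed.

End WreathMatrix.

Lemma mem_conjV_norm (gT : finGroupType) (A : {set gT}) x y :
  x \in 'N(A)%g -> ((x * y * x^-1)%g \in A) = (y \in A).
Proof. by move=> nAx; rewrite -mulgA -{1}[x]invgK -conjgE memJ_norm ?groupV. Qed.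

Lemma unitmx_neq0 (F : fieldType) d (A : 'M[F]_d) :
  (0 < d)%N -> A \in unitmx -> A != 0.
Proof.
by case: d A => // d A _; apply: contraTneq => ->; rewrite unitmxE det0 unitr0.
Qed.

(** * Projective representations, Schur's lemma and the functions [mu] *)

Section ProjAssoc.

Variables (gT : finGroupType) (S : {set gT}) (N : {group gT}) (theta : 'CF(N)).
Variables (d : nat) (P : gT -> 'M[algC]_d) (alpha : gT -> gT -> algC).
Hypothesis irr_theta : theta \in irr N.
Hypothesis PA : proj_assoc S theta P alpha.
Implicit Type u : {rmorphism algC -> algC}.

Lemma proj_assoc1 : P 1%g = 1%:M.
Proof. by case: PA => _ _ []. Qed.

Lemma proj_assoc_deg : d%:R = theta 1%g.
Proof. by case: PA => _ _ _ <- //; rewrite proj_assoc1 mxtrace1. Qed.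

Lemma proj_assoc_gt0 : (0 < d)%N.
Proof.
by rewrite lt0n; apply/eqP=> d0; have := irr1_neq0 (cfIirr theta);
  rewrite cfIirrE // -proj_assoc_deg d0 eqxx.
Qed.

(** Serves the degenerate case in which a nontrivial permutation can centralise the base group. *)
Lemma proj_assoc_trivial : N :=: 1%g -> d = 1%N.
Proof.
move=> N1; apply/eqP; rewrite -(Num.Theory.eqr_nat algC) proj_assoc_deg.
have /char_abelianP lin_chi : abelian N by rewrite N1 abelian1.
by rewrite -(cfIirrE irr_theta) lin_char1 ?lin_chi.
Qed.

Lemma proj_assoc_conj n g : n \in N -> g \in S -> (g * n * g^-1)%g \in N ->
  P (g * n * g^-1)%g *m P g = P g *m P n.
Proof.
case: PA => _ _ _ _ PN nN gS gnN.
by rewrite -(PN _ _ gnN gS).1 mulgKV (PN _ _ nN gS).2.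
Qed.

Lemma factor_set_neq0 x y : x \in S -> y \in S -> alpha x y != 0.
Proof.
case: PA => uP mulP _ _ _ xS yS; apply/eqP=> a0.
have := mulP x y xS yS; rewrite a0 scale0r => PP0.
have /negP[] : P x *m P y != 0.
  by apply: unitmx_neq0; rewrite ?unitmx_mul ?uP ?proj_assoc_gt0.
by rewrite PP0.
Qed.

Let rP : mx_repr N P. Proof. by case: PA. Qed.
Let rG := MxRepresentation rP.

Let cf_rG : cfRepr rG = theta.
Proof. by case: PA => _ _ _ trP _; apply/cfun_inP=> n nN; rewrite cfunE nN trP. Qed.

Let irr_rG : mx_irreducible rG.
Proof.
have /irr_reprP[r irr_r def_r] := irr_theta; apply: mx_rsim_irr irr_r.
by apply: cfRepr_inj; rewrite cf_rG -def_r.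
Qed.

(** Schur's lemma: over the algebraically closed field [algC] the irreducible representation of [N]
    is absolutely irreducible. *)
Lemma proj_assoc_schur B : (forall n, n \in N -> B *m P n = P n *m B) ->
  exists c, B = c%:M.
Proof.
move=> cB; have /is_scalar_mxP[c ->] : is_scalar_mx B; last by exists c.
by apply: (mx_abs_irr_cent_scalar (groupC irr_rG)); apply/centgmxP=> n /cB.
Qed.

(** Only elements of [N] are tested, so no [mu] enters. For irreducible [theta] such an [A] is
    unique up to a scalar, and [mu] measures the failure of the relation on the rest of [S]. *)
Definition intertwines x u (A : 'M_d) :=
  A \in unitmx /\ forall n, n \in N -> A *m map_mx u (P (x * n * x^-1)%g) = P n *m A.

(** Twisting the restriction of [P] to [N] by [x] and [u] gives a representation affording
    [cfGal x u theta], and equal characters make representations similar. *)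
Lemma intertwiner_exists x u : x \in 'N(N)%g -> cfGal x u theta = theta ->
  exists A, intertwines x u A.
Proof.
move=> nNx stab_theta; pose Q n := map_mx u (P (x * n * x^-1)%g).
have xN n : n \in N -> (x * n * x^-1)%g \in N.
  by move=> nN; rewrite mem_conjV_norm.
have rQ : mx_repr N Q.
  split=> [|n1 n2 n1N n2N]; rewrite /Q.
    by rewrite mulg1 mulgV proj_assoc1 map_mx1.
  rewrite -map_mxM -(rP.2 _ _ (xN _ n1N) (xN _ n2N)); congr (map_mx _ (P _)).
  by rewrite !mulgA mulgKV.
have cf_rQ : cfRepr (MxRepresentation rQ) = theta.
  apply/cfun_inP=> n nN; rewrite cfunE nN /= trace_map_mx.
  have [_ _ _ -> //] := PA; last exact: xN.
  rewrite -[in RHS]stab_theta cfunE cfConjgE //.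
  by rewrite conjgE invgK mulgA.
have [B _ freeB simB] : mx_rsim rG (MxRepresentation rQ).
  by apply: cfRepr_inj; rewrite cf_rG.
exists B; split=> [|n nN]; first by rewrite -row_free_unit.
exact: esym (simB n nN).
Qed.

(** Any intertwiner computes [mu]: as [mu] is 1 on [N], the matrix hidden in [mu_spec] also
    intertwines over [N], so it differs from [A] by a scalar, which cancels. *)
Lemma mu_unique x u mu A y c :
    N \subset S -> mu_spec S N P x u mu -> intertwines x u A -> y \in S ->
    A *m map_mx u (P (x * y * x^-1)%g) = c *: (P y *m A) -> mu y = c.
Proof.
move=> /subsetP sNS [mu1 _ muN [A1 uA1 Dmu]] [uA AN] yS Dc.
have [s Ds] : exists s, A *m invmx A1 = s%:M.
  apply: proj_assoc_schur => n nN.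
  have muN1 : mu n = 1 by rewrite -[n]mul1g muN ?mu1 // sNS.
  have := AN n nN; rewrite Dmu ?sNS // muN1 scale1r => /(congr1 (mulmx^~ (invmx A1))).
  by rewrite !mulmxA mulmxK // => ->.
have DA : A = s *: A1 by rewrite -mul_scalar_mx -Ds mulmxKV.
have s0 : s != 0.
  apply/eqP=> s0; have /negP[] := unitmx_neq0 proj_assoc_gt0 uA.
  by rewrite DA s0 scale0r.
move: Dc; rewrite Dmu // DA -!(scalemxAl, scalemxAr) !mulmxA mulmxV // mul1mx.
rewrite !scalerA => /eqP; rewrite -subr_eq0 -scalerBl scaler_eq0 => /orP[|/eqP PA10].
  by rewrite ?[s * _]mulrC -mulrBl mulf_eq0 (negPf s0) orbF subr_eq0 => /eqP.
have [uP _ _ _ _] := PA; have /negP[] : P y *m A1 != 0.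
  by apply: unitmx_neq0; rewrite ?unitmx_mul ?uP ?proj_assoc_gt0.
by rewrite PA10.
Qed.

End ProjAssoc.

(** With [U] the twist of [P], the matrix [A *m U y *m invmx A *m invmx (P y)] commutes with [P] on
    [N], hence is a scalar. The comparison of [mu] and [mu'] in [ge_c] is universally quantified, so
    such functions must be produced before it can be applied. *)
Lemma mu_exists (gT : finGroupType) (K N : {group gT}) (theta : 'CF(N)) d
    (P : gT -> 'M[algC]_d) alpha x (u : {rmorphism algC -> algC}) A :
    theta \in irr N -> proj_assoc K theta P alpha -> (N <| K)%g ->
    x \in 'N(N)%g -> x \in 'N(K)%g -> intertwines N P x u A ->
  exists2 mu, mu_spec K N P x u mu &
    {in K, forall y, A *m map_mx u (P (x * y * x^-1)%g) = mu y *: (P y *m A)}.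
Proof.
move=> irr_theta PA /andP[/subsetP sNK /subsetP nNK] nNx nKx [uA AN].
have [uP mulP rP _ PN] := PA.
have xJ (L : {group gT}) y : x \in 'N(L)%g -> y \in L -> (x * y * x^-1)%g \in L.
  by move=> nLx yL; rewrite mem_conjV_norm.
have xM y z : (x * (y * z) * x^-1)%g = (x * y * x^-1 * (x * z * x^-1))%g.
  by rewrite !mulgA mulgKV.
pose U y := map_mx u (P (x * y * x^-1)%g).
(* Membership in [K] stays inside the existential so that finite choice yields a total function; the
   value 0 outside [K] is a dummy. *)
have ex_mu y : exists c, y \in K -> A *m U y = c *: (P y *m A).
  have [yK | nKy] := boolP (y \in K); last by exists 0.
  have [|c Dc] := proj_assoc_schur irr_theta PA
    (B := A *m U y *m invmx A *m invmx (P y)).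
    move=> n nN; pose n' := (n ^ y)%g.
    have n'N : n' \in N by rewrite memJ_norm // nNK.
    have yn' : (y * n')%g = (n * y)%g by rewrite /n' conjgE mulKVg.
    have e1 : invmx (P y) *m P n = P n' *m invmx (P y).
      apply: (can_inj (mulKmx (uP _ yK))); rewrite mulKVmx ?uP // mulmxA.
      by rewrite -(PN _ _ n'N yK).2 yn' (PN _ _ nN yK).1 mulmxK ?uP.
    have e2 : invmx A *m P n' = U n' *m invmx A.
      by apply: (can_inj (mulKmx uA)); rewrite mulKVmx // mulmxA AN // mulmxK.
    have e3 : U y *m U n' = U n *m U y.
      rewrite -!map_mxM -(PN _ _ (xJ _ _ nNx n'N) (xJ _ _ nKx yK)).2.
      by rewrite -(PN _ _ (xJ _ _ nNx nN) (xJ _ _ nKx yK)).1 -!xM yn'.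
    rewrite -!mulmxA e1 (mulmxA (invmx A)) e2 -mulmxA (mulmxA (U y)) e3.
    by rewrite !mulmxA (AN _ nN).
  exists c => _; move/(congr1 (fun B => B *m P y *m A)): Dc.
  by rewrite !mulmxKV ?uP // mul_scalar_mx scalemxAl.
have [mu Dmu] := fin_all_exists ex_mu.
have mu_uniq y c1 c2 : y \in K -> c1 *: (P y *m A) = c2 *: (P y *m A) -> c1 = c2.
  move=> yK /eqP; rewrite -subr_eq0 -scalerBl scaler_eq0 => /orP[|/eqP PA0].
    by rewrite subr_eq0 => /eqP.
  have /negP[] : P y *m A != 0.
    by apply: unitmx_neq0; rewrite ?unitmx_mul ?uP ?(proj_assoc_gt0 irr_theta PA).
  by rewrite PA0.
exists mu => //; split.
- apply: (mu_uniq 1%g) => //; rewrite -Dmu // scale1r /U mulg1 mulgV.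
  by rewrite (proj_assoc1 PA) map_mx1 mulmx1 mul1mx.
- move=> y yK; apply/eqP=> mu0; have := Dmu y yK; rewrite mu0 scale0r => AU0.
  have /negP[] : A *m U y != 0.
    apply: unitmx_neq0; rewrite ?unitmx_mul ?uA ?(proj_assoc_gt0 irr_theta PA) //.
    by rewrite map_unitmx uP // xJ.
  by rewrite AU0.
- move=> y n yK nN; have ynK : (y * n)%g \in K by rewrite groupM // sNK.
  apply: (mu_uniq (y * n)%g) => //; rewrite -Dmu //.
  rewrite (PN _ _ nN yK).2 /U xM (PN _ _ (xJ _ _ nNx nN) (xJ _ _ nKx yK)).2 map_mxM.
  by rewrite mulmxA Dmu // -!scalemxAl -!mulmxA AN.
exists A => // y yK; apply: (can_inj (mulKmx uA)).
by rewrite Dmu // -scalemxAr mulmxA mulKVmx.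
Qed.

(** * Intertwiners along one coset of the inertia group *)

Section TwistByTransversal.

Variables (gT : finGroupType) (S : {set gT}) (N : {group gT}) (theta : 'CF(N)).
Variables (d : nat) (P : gT -> 'M[algC]_d) (alpha : gT -> gT -> algC).
Variables (u : {rmorphism algC -> algC}) (r : gT) (A : 'M[algC]_d).
Hypothesis irr_theta : theta \in irr N.
Hypothesis PA : proj_assoc S theta P alpha.

(* If A intertwines P^(r u) with P, then so does [shift_intertwiner a] for
   P^(a u), for all a in the coset S r. *)
Definition shift_intertwiner a := A *m invmx (map_mx u (P (a * r^-1)%g)).

Lemma shift_intertwines a : r \in 'N(N)%g -> a \in 'N(N)%g -> (a * r^-1)%g \in S ->
  intertwines N P r u A -> intertwines N P a u (shift_intertwiner a).
Proof.
have [uP _ _ _ _] := PA => nNr nNa tS [uA AN].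
have uUt : map_mx u (P (a * r^-1)%g) \in unitmx by rewrite map_unitmx uP.
split=> [|n nN]; first by rewrite unitmx_mul uA unitmx_inv.
have Jn x : x \in 'N(N)%g -> (x * n * x^-1)%g \in N.
  by move=> nNx; rewrite mem_conjV_norm.
apply: (can_inj (mulmxK uUt)).
(* Conjugation by [a] is reached from conjugation by [r] through [a * r^-1], which [P] realises as a
   matrix conjugation. *)
have Da : (a * r^-1 * (r * n * r^-1) * (a * r^-1)^-1 = a * n * a^-1)%g.
  by rewrite invMg invgK !mulgA !mulgKV.
rewrite -[LHS]mulmxA -map_mxM -{1}Da (proj_assoc_conj PA) ?Da ?Jn //.
by rewrite map_mxM mulmxA /shift_intertwiner mulmxKV // AN // -[RHS]mulmxA mulmxKV.
Qed.

(** Two translates [a] and [b] occur because a coordinate of [x * y * x^-1] in the wreath product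
    involves two coordinates of [x]. Apart from [c], the scalar depends only on the factor set and
    [u], so it agrees for representations with the same factor set. *)
Lemma shift_twist a b y c : (a * r^-1)%g \in S -> (b * r^-1)%g \in S ->
    (r * y * r^-1)%g \in S -> (a * y * b^-1)%g \in S ->
    A *m map_mx u (P (r * y * r^-1)%g) = c *: (P y *m A) ->
  shift_intertwiner a *m map_mx u (P (a * y * b^-1)%g) =
    (u (alpha (a * y * b^-1)%g (b * r^-1)%g / alpha (a * r^-1)%g (r * y * r^-1)%g) * c)
      *: (P y *m shift_intertwiner b).
Proof.
have [uP mulP _ _ _] := PA => taS tbS ryS ayS Dc.
have uU t : t \in S -> map_mx u (P t) \in unitmx by move=> tS; rewrite map_unitmx uP.
apply: (can_inj (mulmxK (uU _ tbS))).
have E1 : (a * y * b^-1 * (b * r^-1) = a * y * r^-1)%g by rewrite !mulgA mulgKV.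
have E2 : (a * r^-1 * (r * y * r^-1) = a * y * r^-1)%g by rewrite !mulgA mulgKV.
have a0 := factor_set_neq0 irr_theta PA taS ryS.
have DP : P (a * y * r^-1)%g =
    (alpha (a * r^-1)%g (r * y * r^-1)%g)^-1 *: (P (a * r^-1)%g *m P (r * y * r^-1)%g).
  by rewrite mulP // E2 scalerA mulVf // scale1r.
rewrite -[LHS]mulmxA -map_mxM mulP // E1 DP scalerA map_mxZ map_mxM.
rewrite -scalemxAr mulmxA /shift_intertwiner mulmxKV ?uU // Dc scalerA.
by rewrite -scalemxAl -[P y *m _ *m _]mulmxA mulmxKV ?uU.
Qed.

End TwistByTransversal.

(** * Coordinates in the wreath product and its base group *)

Section WreathGroup.

Variables (gT : finGroupType) (n : nat).
Implicit Types (x y : wreath_type gT n) (A : {set gT}).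

Lemma wr_mul1E x y i : (x * y)%g.1 i = (x.1 i * y.1 (x.2 i))%g.
Proof. by rewrite ffunE. Qed.

Lemma wr_mul2E x y : (x * y)%g.2 = (x.2 * y.2)%g. Proof. by []. Qed.

Lemma wr_inv1E x i : (x^-1)%g.1 i = ((x.1 (x.2^-1%g i))^-1)%g.
Proof. by rewrite ffunE. Qed.

Lemma wr_inv2E x : (x^-1)%g.2 = (x.2^-1)%g. Proof. by []. Qed.

Lemma wr_one1E i : (1%g : wreath_type gT n).1 i = 1%g.
Proof. by rewrite ffunE. Qed.

Lemma wr_conj1E x y i :
  (x * y * x^-1)%g.1 i =
    (x.1 i * y.1 (x.2 i) * (x.1 (x.2^-1%g (y.2 (x.2 i))))^-1)%g.
Proof. by rewrite !wr_mul1E wr_inv1E wr_mul2E permM. Qed.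

Lemma mem_wreath A x : reflect (forall i, x.1 i \in A) (x \in wreath n A).
Proof. by rewrite inE; apply: forallP. Qed.

Lemma mem_base (N : {group gT}) x :
  reflect (x.2 = 1%g /\ forall i, x.1 i \in N) (x \in base n N).
Proof.
rewrite inE; apply: (iffP andP) => [[/eqP ? /forallP]|[? ?]] //.
by split; [apply/eqP | apply/forallP].
Qed.

Lemma wreath_norm_base (N : {group gT}) x :
  x \in wreath n 'N(N)%g -> x \in 'N(base n N)%g.
Proof.
move/mem_wreath=> nNx; rewrite -groupV inE; apply/subsetP=> _ /imsetP[y yN ->].
have [y2 /= y1] := mem_base _ _ yN; apply/mem_base.
rewrite conjgE invgK; split=> [|i].
  by rewrite !wr_mul2E y2 mul1g wr_inv2E mulgV.
rewrite mulgA wr_conj1E y2 perm1 permK.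
by rewrite mem_conjV_norm.
Qed.

Lemma big_base (N : {group gT}) (F : 'I_n -> gT -> algC) :
  \sum_(x in base n N) \prod_i F i (x.1 i) = \prod_i \sum_(g in N) F i g.
Proof.
rewrite bigA_distr_big (reindex_onto (fun f : {ffun 'I_n -> gT} => (f, 1%g))
  (fun x : wreath_type gT n => x.1)) /=.
  apply: eq_bigl => f; rewrite eqxx andbT; apply/mem_base/ffun_onP => [[_ //]|fN].
  by split.
by move=> [f w] /mem_base[/= -> _].
Qed.

Lemma base_delta (N : {group gT}) i g : g \in N ->
  ([ffun j => if j == i then g else 1%g], 1%g) \in base n N.
Proof. by move=> gN; apply/mem_base; split=> // j; rewrite ffunE; case: ifP. Qed.

End WreathGroup.

(** * Product characters of the base group *)

Section WreathCharacter.

Variables (gT : finGroupType) (n : nat) (N : {group gT}) (theta : 'CF(N)).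
Variables (s : 'I_n -> {rmorphism algC -> algC}) (thetat : 'CF(base n N)).
Hypothesis irr_theta : theta \in irr N.
Hypothesis Dthetat : forall x, x \in base n N ->
  thetat x = \prod_i cfAut (s i) theta (x.1 i).

Lemma base_repr d (P : gT -> 'M[algC]_d) : mx_repr N P ->
  mx_repr (base n N) (fun x => wrmx (fun i => map_mx (s i) (P (x.1 i))) x.2).
Proof.
move=> [P1 PM]; split.
  by rewrite -wrmx1; apply: eq_wrmx => i; rewrite wr_one1E P1 map_mx1.
move=> x y /mem_base[x2 xN] /mem_base[y2 yN].
rewrite wrmxM wr_mul2E; apply: eq_wrmx => i.
by rewrite wr_mul1E PM // map_mxM x2 perm1.
Qed.

Lemma base_trace d (P : gT -> 'M[algC]_d) :
    (forall g, g \in N -> \tr (P g) = theta g) ->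
  forall x, x \in base n N ->
    \tr (wrmx (fun i => map_mx (s i) (P (x.1 i))) x.2) = thetat x.
Proof.
move=> trP x xN; rewrite Dthetat //; have [-> x1] := mem_base _ _ xN.
by rewrite mxtrace_wrmx; apply: eq_bigr => i _; rewrite trace_map_mx trP // cfunE.
Qed.

(** [thetat] is afforded by a tensor product of Galois conjugates, and its norm factors over the
    coordinates into norms equal to 1. *)
Lemma base_irr : thetat \in irr (base n N).
Proof.
rewrite irrEchar; apply/andP; split.
  have [[d [P rP]] _ def_theta] := irr_reprP irr_theta.
  suffices -> : thetat = cfRepr (MxRepresentation (base_repr rP)).
    exact: cfRepr_char.
  apply/cfun_inP=> x xN; rewrite cfunE xN /=; apply/esym/base_trace => // g gN.
  by rewrite def_theta cfunE gN.
have card_base : #|base n N|%:R = \prod_(i < n) #|N|%:R :> algC.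
  rewrite -!sum1_card !natr_sum -(big_base _ (fun _ _ => 1)).
  by apply: eq_bigr => x _; rewrite big1.
rewrite cfdotE card_base; pose E i g := cfAut (s i) theta g * (cfAut (s i) theta g)^*.
rewrite (eq_bigr (fun x : wreath_type gT n => \prod_i E i (x.1 i))) => [|x xN];
  last first.
  by rewrite Dthetat // rmorph_prod -big_split.
rewrite big_base -prodfV -big_split big1 // => i _.
transitivity '[cfAut (s i) theta]; first by rewrite cfdotE.
by rewrite irrWnorm // cfAut_irr.
Qed.

(** For the forward direction, evaluate at elements supported on one coordinate: the remaining
    factors are degrees, which are nonzero and agree on both sides, so they cancel. *)
Lemma cfGal_base x u : x \in wreath n 'N(N)%g ->
  cfGal x u thetat = thetat <->
  forall i, cfAut u (cfAut (s i) theta ^ x.1 i)%CF = cfAut (s (x.2 i)) theta.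
Proof.
move=> xW; have nNx := mem_wreath _ _ xW; have nBx := wreath_norm_base xW.
have JN (g y : gT) : g \in 'N(N)%g -> y \in N -> (y ^ g^-1)%g \in N.
  by move=> nNg yN; rewrite memJ_norm ?groupV.
have Dx y : y \in base n N -> cfGal x u thetat y =
    \prod_i cfAut u (cfAut (s i) theta ^ x.1 i)%CF (y.1 (x.2 i)).
  move=> yN; have [y2 y1] := mem_base _ _ yN.
  rewrite cfunE cfConjgE // Dthetat ?memJ_norm ?groupV //.
  rewrite rmorph_prod; apply: eq_bigr => i _.
  rewrite [in RHS]cfunE [in RHS]cfConjgE // !conjgE !invgK.
  by rewrite mulgA wr_conj1E y2 perm1 permK mulgA.
have Dt y : y \in base n N -> thetat y = \prod_i cfAut (s (x.2 i)) theta (y.1 (x.2 i)).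
  by move=> yN; rewrite Dthetat // (reindex_perm x.2).
split=> [stab_t i | stab_i]; last first.
  by apply/cfun_inP=> y yN; rewrite Dx // Dt //; apply: eq_bigr => i _; rewrite stab_i.
have deg j : cfAut u (cfAut (s j) theta ^ x.1 j)%CF 1%g = cfAut (s (x.2 j)) theta 1%g.
  by rewrite cfunE cfConjg1 !cfunE -(cfIirrE irr_theta) irr1_degree !rmorph_nat.
apply/cfun_inP=> g gN.
set y : wreath_type gT n := ([ffun j => if j == x.2 i then g else 1%g], 1%g).
have yN : y \in base n N by exact: base_delta.
have := congr1 (fun f : 'CF(_) => f y) stab_t; rewrite Dx // Dt //.
rewrite (bigD1 i) //= [RHS](bigD1 i) //= ffunE eqxx.
have y1 j : j != i -> [ffun j0 => if j0 == x.2 i then g else 1%g] (x.2 j) = 1%g.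
  by move=> ne_ji; rewrite ffunE (inj_eq perm_inj) (negPf ne_ji).
rewrite [X in _ * X](eq_bigr (fun j => cfAut (s (x.2 j)) theta 1%g)); last first.
  by move=> j ne_ji; rewrite y1.
rewrite [X in _ = _ * X](eq_bigr (fun j => cfAut (s (x.2 j)) theta 1%g)); last first.
  by move=> j ne_ji; rewrite y1.
apply: mulIf; apply/prodf_neq0=> j _.
by rewrite cfunE fmorph_eq0 -(cfIirrE irr_theta) irr1_neq0.
Qed.

End WreathCharacter.

(** * The projective representation on the tensor power and its twists *)

Section WreathProj.

Variables (gT : finGroupType) (n : nat) (N : {group gT}) (theta : 'CF(N)).
Variables (s : 'I_n -> {rmorphism algC -> algC}) (thetat : 'CF(base n N)).
Hypothesis Dthetat : forall x, x \in base n N ->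
  thetat x = \prod_i cfAut (s i) theta (x.1 i).
Variables (S : {set gT}) (d : nat) (P : gT -> 'M[algC]_d) (alpha : gT -> gT -> algC).
Hypothesis PA : proj_assoc S theta P alpha.
Implicit Types x y : wreath_type gT n.

Definition wr_repr x := wrmx (fun i => map_mx (s i) (P (x.1 i))) x.2.

Definition wr_factor_set x y := \prod_i s i (alpha (x.1 i) (y.1 (x.2 i))).

Variable St : {set wreath_type gT n}.
Hypothesis StS : forall y, y \in St -> forall i, y.1 i \in S.
Hypothesis Sts : forall y, y \in St -> forall i, s (y.2 i) = s i.

(** By [Sts] the two matrices multiplied at coordinate [i] are twisted by the same automorphism, so
    the relations for [P] apply coordinatewise. *)
Lemma wr_proj_assoc : proj_assoc St thetat wr_repr wr_factor_set.
Proof.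
have [uP mulP rP trP PN] := PA; split.
- by move=> x /StS xS; apply: wrmx_unit => i; rewrite map_unitmx uP.
- move=> x y xSt ySt; rewrite wrmxM -wrmxZ; apply: eq_wrmx => i.
  by rewrite Sts // -map_mxM mulP ?StS // map_mxZ wr_mul1E.
- exact: base_repr rP.
- by move=> x xN; rewrite -(base_trace Dthetat trP).
move=> x y /mem_base[x2 xN] ySt; split; rewrite /wr_repr wrmxM wr_mul2E.
  apply: eq_wrmx => i; rewrite wr_mul1E x2 perm1 -map_mxM.
  by rewrite (PN _ _ (xN i) (StS ySt i)).1.
apply: eq_wrmx => i; rewrite wr_mul1E Sts // -map_mxM.
by rewrite (PN _ _ (xN _) (StS ySt i)).2.
Qed.

Lemma wr_entries_Qab : entries_Qab S P -> entries_Qab St wr_repr.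
Proof.
move=> QP x xSt i j; rewrite mxE; apply: Qab_prod => l.
by rewrite mxE; apply/Qab_aut/QP/StS.
Qed.

Lemma wr_root_factor_set : root_factor_set S alpha -> root_factor_set St wr_factor_set.
Proof.
move=> ra x y xSt ySt; apply: root_of_unity_prod => i.
have [e [e0 ae]] := ra _ _ (StS xSt i) (StS ySt (x.2 i)).
by exists e; split; rewrite // -rmorphXn ae rmorph1.
Qed.

Lemma wr_repr_scalar x (lam : 'I_n -> algC) :
    (forall i, P (x.1 i) = (lam i)%:M) -> x.2 = 1%g \/ d = 1%N ->
  wr_repr x = (\prod_i s i (lam i))%:M.
Proof.
move=> Plam Hx; rewrite /wr_repr.
rewrite (eq_wrmx (B := fun i => (s i (lam i))%:M)) => [|i]; last first.
  by rewrite Plam map_scalar_mx.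
by case: Hx => [-> | d1]; [apply: wrmx_scalar | apply: wrmx_dim1].
Qed.

Variables (x : wreath_type gT n) (u : {rmorphism algC -> algC}).
Variables (tau : 'I_n -> {rmorphism algC -> algC}) (A : 'I_n -> 'M[algC]_d).
Hypothesis s_tau : forall l c, s (x.2 l) (tau l c) = u (s l c).

(** The inverse permutation undoes the relabelling of tensor factors by [x]: multiplied by the twist
    at [y], it leaves the permutation [y.2 * x.2^-1], as on the other side of the relation. *)
Definition wr_intertwiner :=
  wrmx (fun i => map_mx (s i) (A (x.2^-1%g i))) x.2^-1.

Lemma wr_twist y (c : 'I_n -> algC) : (forall i, s (y.2 i) = s i) ->
    (forall l, A l *m map_mx (tau l) (P ((x * y * x^-1)%g.1 l)) =
       c l *: (P (y.1 (x.2 l)) *m A (x.2^-1%g (y.2 (x.2 l))))) ->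
  wr_intertwiner *m map_mx u (wr_repr (x * y * x^-1)%g) =
    (\prod_l s (x.2 l) (c l)) *: (wr_repr y *m wr_intertwiner).
Proof.
move=> sy Hc; rewrite /wr_intertwiner /wr_repr map_wrmx !wrmxM.
rewrite !wr_mul2E wr_inv2E !mulgA mulVg mul1g.
have -> : \prod_l s (x.2 l) (c l) = \prod_i s i (c (x.2^-1%g i)).
  rewrite [RHS](reindex_perm x.2).
  by apply: eq_bigr => l _; rewrite permK.
rewrite -wrmxZ; apply: eq_wrmx => i; set l := (x.2^-1%g i).
have Di : i = x.2 l by rewrite /l permKV.
(* Factoring $u s_l = s_i\tau_l$ puts every matrix at coordinate [i] under the common automorphism
   [s i]. *)
have -> : map_mx u (map_mx (s l) (P ((x * y * x^-1)%g.1 l))) =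
    map_mx (s i) (map_mx (tau l) (P ((x * y * x^-1)%g.1 l))).
  by apply/matrixP=> a b; rewrite !mxE Di s_tau.
by rewrite sy -!map_mxM Hc -Di map_mxZ.
Qed.

Lemma wr_intertwines : (forall l, intertwines N P (x.1 l) (tau l) (A l)) ->
  intertwines (base n N) wr_repr x u wr_intertwiner.
Proof.
move=> HA; split=> [|y /mem_base[y2 yN]].
  by apply: wrmx_unit => i; rewrite map_unitmx; case: (HA (x.2^-1%g i)).
rewrite (wr_twist (c := fun=> 1)) => [||l].
- by rewrite big1 ?scale1r // => i _; rewrite rmorph1.
- by move=> i; rewrite y2 perm1.
by rewrite wr_conj1E y2 perm1 permK (HA l).2 // scale1r.
Qed.

End WreathProj.

(** * Galois conjugation and stabilisers of characters *)

Lemma cfAut_comp (gT : finGroupType) (N : {group gT}) (u v : {rmorphism algC -> algC})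
    (chi : 'CF(N)) : cfAut (u \o v) chi = cfAut u (cfAut v chi).
Proof. by apply/cfunP=> x; rewrite !cfunE. Qed.

Lemma cfAut_id (gT : finGroupType) (N : {group gT}) (chi : 'CF(N)) :
  cfAut idfun chi = chi.
Proof. by apply/cfunP=> x; rewrite cfunE. Qed.

Lemma cfAut_inj (gT : finGroupType) (N : {group gT}) (u : {rmorphism algC -> algC}) :
  injective (cfAut u : 'CF(N) -> 'CF(N)).
Proof. exact: can_inj (cfAutK u). Qed.

Lemma cfGal_id (gT : finGroupType) (N : {group gT}) g (chi : 'CF(N)) :
  cfGal g idfun chi = (chi ^ g)%CF.
Proof. exact: cfAut_id. Qed.

Lemma inertiaE (gT : finGroupType) (G N : {group gT}) (chi : 'CF(N)) g :
  (N <| G)%g -> g \in G -> (g \in 'I_G[chi]%g) <-> cfGal g idfun chi = chi.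
Proof.
move=> /andP[_ /subsetP nNG] gG; rewrite cfGal_id in_setI gG inE nNG //=.
by split=> [/eqP | ->].
Qed.

(** Passes from $\chi^x=\chi^u$ to a pair fixing [chi] by replacing [u] with its inverse, which
    again lies in $\mathcal H$. *)
Lemma stabHorbP (gT : finGroupType) p (A : {set gT}) (N : {group gT}) (chi : 'CF(N)) x :
    prime p ->
  x \in stabHorb p A chi <-> x \in A /\ exists2 u, inH p u & cfGal x u chi = chi.
Proof.
move=> p_pr; rewrite inE; split=> [/andP[xA /pboolP[u [uH Du]]] | [xA [u uH Du]]].
  by split=> //; exists (algC_invaut u); [apply: inH_inv | rewrite /cfGal Du cfAutK].
rewrite xA; apply/pboolP; exists (algC_invaut u); split; first exact: inH_inv.
by rewrite -{2}Du /cfGal cfAutK.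
Qed.

(** $\chi^x$ is a Galois conjugate of $\chi$, and Galois action commutes with conjugation, so both
    have the same inertia group. *)
Lemma norm_inertia_cfGal (gT : finGroupType) (G N : {group gT}) (chi : 'CF(N)) x u :
  (N <| G)%g -> x \in G -> cfGal x u chi = chi -> x \in 'N('I_G[chi])%g.
Proof.
move=> nNG xG stab_chi; rewrite -groupV inE; apply/subsetP=> _ /imsetP[y yI ->].
have yG : y \in G by case/setIP: yI.
have Dx : (chi ^ x)%CF = cfAut (algC_invaut u) chi.
  by rewrite -{2}stab_chi /cfGal cfAutK.
apply/inertiaE => //; first by rewrite conjgE invgK !groupM ?groupV.
have /inertiaE := yI; rewrite !cfGal_id => chi_y.
rewrite conjgE invgK !(cfConjgM _ nNG) ?groupM ?groupV //.
by rewrite Dx -cfAutConjg chi_y // -Dx cfConjgK.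
Qed.

(** * Blocks of coordinates and the stabiliser of the block character *)

Section BlockCharacter.

Variables (gT : finGroupType) (n k : nat) (b : 'I_n -> 'I_k).
Variable sigma : 'I_k -> {rmorphism algC -> algC}.
Variables (G N : {group gT}) (theta : 'CF(N)) (thetat : 'CF(base n N)).
Hypothesis nNG : (N <| G)%g.
Hypothesis irr_theta : theta \in irr N.
Hypothesis Dthetat : forall x, x \in base n N ->
  thetat x = \prod_i cfAut (sigma (b i)) theta (x.1 i).
Implicit Types (x y : wreath_type gT n) (u : {rmorphism algC -> algC}).

(* The automorphism sigma_{b(x i)}^-1 u sigma_{b(i)}, with which the i-th
   coordinate of x fixes theta when (x, u) fixes thetat. *)
Definition coord_aut x u i : {rmorphism algC -> algC} :=
  algC_invaut (sigma (b (x.2 i))) \o (u \o sigma (b i)).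

Lemma coord_autE x u i c :
  sigma (b (x.2 i)) (coord_aut x u i c) = u (sigma (b i) c).
Proof. exact: algC_invautK. Qed.

Lemma cfGal_wreath x u : x \in wreath n G ->
  cfGal x u thetat = thetat <->
  forall i, cfGal (x.1 i) (coord_aut x u i) theta = theta.
Proof.
move=> /mem_wreath xG; have xN : x \in wreath n 'N(N)%g.
  by apply/mem_wreath=> i; apply: (subsetP (normal_norm nNG)).
rewrite (cfGal_base irr_theta (s := fun i => sigma (b i)) Dthetat u xN).
have E i : cfGal (x.1 i) (coord_aut x u i) theta =
    cfAut (algC_invaut (sigma (b (x.2 i))))
      (cfAut u (cfAut (sigma (b i)) theta ^ x.1 i)%CF).
  by rewrite /cfGal !cfAut_comp cfAutConjg.
by split=> Hx i; [rewrite E Hx cfAutK | rewrite -[in RHS](Hx i) E cfAutVK].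
Qed.

Hypothesis nonconj : forall i j g, g \in G ->
  (cfAut (sigma i) theta ^ g)%CF = cfAut (sigma j) theta -> i = j.

(** Up to [G]-conjugacy, the conjugate at [x.2 i] is the [u]-image of the one at [i]. Equal blocks
    on either side thus give [G]-conjugate characters on the other, and [nonconj] applies. *)
Lemma stab_blocks x u i j : x \in wreath n G -> cfGal x u thetat = thetat ->
  (b (x.2 i) = b (x.2 j) <-> b i = b j).
Proof.
move=> xG /(cfGal_wreath u xG) stab_x; have {xG}xG := mem_wreath _ _ xG.
have E l : (cfAut u (cfAut (sigma (b l)) theta) ^ x.1 l)%CF =
    cfAut (sigma (b (x.2 l))) theta.
  apply: (can_inj (cfAutK (algC_invaut (sigma (b (x.2 l)))))) => /=.
  by rewrite cfAutK -cfAutConjg -cfAutConjg -[in RHS](stab_x l) /cfGal !cfAut_comp.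
have jiG : ((x.1 j)^-1 * x.1 i)%g \in G by rewrite groupM ?groupV.
have ijG : (x.1 i * (x.1 j)^-1)%g \in G by rewrite groupM ?groupV.
split=> [eq_xb | eq_b].
  apply: (nonconj ijG); rewrite (cfConjgM _ nNG) ?groupV //.
  apply: (@cfAut_inj _ _ u); rewrite !cfAutConjg E eq_xb -E.
  by rewrite cfConjgK.
symmetry; apply: (nonconj jiG).
by rewrite (cfConjgM _ nNG) ?groupV // -(E j) cfConjgK -eq_b E.
Qed.

Lemma stab_coord_aut x u i j : x \in wreath n G -> cfGal x u thetat = thetat ->
  b i = b j -> coord_aut x u i = coord_aut x u j.
Proof.
move=> xG stab_x eq_b; rewrite /coord_aut eq_b.
by rewrite ((stab_blocks i j xG stab_x).2 eq_b).
Qed.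

(** Supplies the hypotheses [StS] and [Sts] of the wreath representation: without a Galois twist,
    [y.1 i] itself conjugates one $\theta_j$ into another. *)
Lemma inertia_blocks y i :
    y \in wreath n G -> (thetat ^ y)%CF = thetat ->
  b (y.2 i) = b i /\ y.1 i \in 'I_G[theta]%g.
Proof.
move=> yG; rewrite -cfGal_id => stab_y; have yiG := mem_wreath _ _ yG i.
have stab_i := (cfGal_wreath _ yG).1 stab_y i.
have eq_b : b i = b (y.2 i).
  apply: (nonconj yiG); rewrite -cfAutConjg -[in RHS]stab_i.
  by rewrite /cfGal !cfAut_comp cfAutVK cfAut_id.
split=> //; apply/inertiaE => //; rewrite cfGal_id -[RHS]stab_i /cfGal !cfAut_comp.
by rewrite cfAut_id -eq_b cfAutK.
Qed.


End BlockCharacter.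

Lemma coset_inertia (gT : finGroupType) (G N : {group gT}) (chi : 'CF(N)) u g h :
    (N <| G)%g -> g \in G -> h \in G -> cfGal g u chi = chi -> cfGal h u chi = chi ->
  (g * h^-1)%g \in 'I_G[chi]%g.
Proof.
move=> nNG gG hG stab_g stab_h; have ghG : (g * h^-1)%g \in G by rewrite groupM ?groupV.
apply/inertiaE => //; rewrite cfGal_id (cfConjgM _ nNG) ?groupV //.
have -> : (chi ^ g)%CF = (chi ^ h)%CF.
  by apply: (@cfAut_inj _ _ u); rewrite -/(cfGal g u chi) stab_g.
by rewrite cfConjgK.
Qed.

(** * The relation [ge_c] between the wreath product triples *)

Section WreathTriple.

Variables (p : nat) (gT : finGroupType) (G N H M : {group gT}).
Variables (theta : 'CF(N)) (phi : 'CF(M)) (n k : nat) (b : 'I_n -> 'I_k).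
Variables (sigma : 'I_k -> {rmorphism algC -> algC}).
Variables (thetat : 'CF(base n N)) (phit : 'CF(base n M)).
Hypothesis p_pr : prime p.
Hypothesis GHge : ge_c p G theta H phi.
Hypothesis sigmaH : forall i, inH p (sigma i).
Hypothesis nonconj : forall i j g, g \in G ->
  (cfAut (sigma i) theta ^ g)%CF = cfAut (sigma j) theta -> i = j.
Hypothesis Dthetat : forall x, x \in base n N ->
  thetat x = \prod_i cfAut (sigma (b i)) theta (x.1 i).
Hypothesis Dphit : forall x, x \in base n M ->
  phit x = \prod_i cfAut (sigma (b i)) phi (x.1 i).

Let nNG : (N <| G)%g. Proof. by case: GHge => [[[]]]. Qed.
Let nMH : (M <| H)%g. Proof. by case: GHge => [[_ []]]. Qed.
Let irr_theta : theta \in irr N. Proof. by case: GHge => [[[]]]. Qed.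
Let irr_phi : phi \in irr M. Proof. by case: GHge => [[_ []]]. Qed.
Let sHG : H \subset G. Proof. by case: GHge. Qed.
Let sH g : g \in H -> g \in G. Proof. exact: (subsetP sHG). Qed.

Let same_stab h u : h \in H -> inH p u ->
  cfGal h u theta = theta <-> cfGal h u phi = phi.
Proof. by case: GHge => _ _ _ stab _; apply: stab. Qed.

Let IHE : 'I_H[theta]%g = 'I_H[phi]%g.
Proof.
apply/setP=> h; rewrite [LHS]in_setI; have [hH | nHh] := boolP (h \in H); last first.
  by rewrite in_setI (negPf nHh).
apply/idP/idP=> hI.
  apply/inertiaE => //; apply/same_stab => //; first exact: inH_id.
  by apply/(inertiaE theta nNG); rewrite ?sH // in_setI sH.
have stab_h : cfGal h idfun theta = theta.
  by apply/same_stab => //; [apply: inH_id | apply/(inertiaE phi nMH)].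
by case/(inertiaE theta nNG (sH hH))/setIP: stab_h.
Qed.

Let sIHG : {subset 'I_H[phi]%g <= 'I_G[theta]%g}.
Proof. by move=> h; rewrite -IHE => /setIP[hH hI]; rewrite in_setI sH. Qed.

Let wreath_sub x : x \in wreath n H -> x \in wreath n G.
Proof. by move/mem_wreath=> xH; apply/mem_wreath=> i; apply: sH. Qed.

Let same_stab_wreath x u : x \in wreath n H -> inH p u ->
  cfGal x u thetat = thetat <-> cfGal x u phit = phit.
Proof.
move=> xH uH; have xiH := mem_wreath _ _ xH.
rewrite (cfGal_wreath nNG irr_theta Dthetat u (wreath_sub xH)).
rewrite (cfGal_wreath nMH irr_phi Dphit u xH).
have tauH i : inH p (coord_aut b sigma x u i).
  by do !apply: inH_comp => //; apply: inH_inv.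
by split=> Hx i; apply/same_stab.
Qed.

Let GT := stabHorb p (wreath n G) thetat.
Let HT := stabHorb p (wreath n H) phit.

Let HT_GT x : x \in HT <-> x \in wreath n H /\ x \in GT.
Proof.
rewrite !stabHorbP //; split=> [[xH [u uH /same_stab_wreath st]] | [xH [_ [u uH st]]]].
  by split=> //; split; [apply: wreath_sub | exists u; last exact: st].
by split=> //; exists u => //; apply/same_stab_wreath.
Qed.

Let Htriple_wreath (A K : {group gT}) (chi : 'CF(K)) (chit : 'CF(base n K)) :
    (K <| A)%g -> chi \in irr K ->
    (forall x, x \in base n K -> chit x = \prod_i cfAut (sigma (b i)) chi (x.1 i)) ->
  Htriple p (stabHorb p (wreath n A) chit) chit.
Proof.
move=> /andP[/subsetP sKA /subsetP nKA] irr_chi Dchit; split.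
- apply/andP; split; apply/subsetP=> x.
    move=> xK; apply/stabHorbP => //; split.
      by have [_ x1] := mem_base _ _ xK; apply/mem_wreath=> i; apply: sKA.
    exists idfun; first exact: inH_id.
    by rewrite cfGal_id cfConjg_id.
  case/stabHorbP=> // /mem_wreath xA _.
  by apply: wreath_norm_base; apply/mem_wreath=> i; apply: nKA.
- exact: (base_irr irr_chi Dchit).
by apply/setP=> x; rewrite [LHS]inE; apply: andb_idr; rewrite inE => /andP[].
Qed.

(** Elements of $N^n$ fix every class function of $N^n$ under conjugation. *)
Let base_mul_GT y z : y \in base n N -> (y * z \in GT)%g = (z \in GT).
Proof.
move=> yN; have [y2 y1] := mem_base _ _ yN.
have yzG : ((y * z)%g \in wreath n G) = (z \in wreath n G).
  rewrite !inE; apply: eq_forallb => i; rewrite /wr_fun wr_mul1E y2 perm1.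
  by rewrite groupMl // (subsetP (normal_sub nNG)).
have nBG x : x \in wreath n G -> x \in 'N(base n N)%g.
  move/mem_wreath=> xG; apply: wreath_norm_base; apply/mem_wreath=> i.
  exact: (subsetP (normal_norm nNG)).
rewrite [in LHS]inE [in RHS]inE yzG; apply: andb_id2l => zG.
suffices -> : (thetat ^ (y * z) = thetat ^ z)%CF by [].
rewrite (cfConjgMnorm thetat (subsetP (normG _) _ yN) (nBG _ zG)).
by rewrite (cfConjg_id thetat yN).
Qed.

Let GT_mul : GT = (base n N * HT)%g.
Proof.
have [_ _ [DG _ _] _ _] := GHge.
apply/setP=> x; apply/idP/mulsgP=> [xGT | [y z yN /HT_GT[_ zGT] ->]]; last first.
  by rewrite base_mul_GT.
have [xG _] := (stabHorbP _ _ _ p_pr).1 xGT.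
(* Strip an [N]-part from each coordinate by [G = N * H]; the whole permutation stays with the
   [H]-part. *)
have /fin_all_exists2[f fN fH] i : exists2 g, g \in N & (g^-1 * x.1 i)%g \in H.
  have := mem_wreath _ _ xG i; rewrite DG => /mulsgP[g h gN hH ->].
  by exists g; rewrite // mulKg.
pose y : wreath_type gT n := (finfun f, 1%g).
have yN : y \in base n N by apply/mem_base; split=> // i; rewrite ffunE.
exists y (y^-1 * x)%g; rewrite ?mulKVg //; apply/HT_GT; split.
  apply/mem_wreath=> i; rewrite wr_mul1E wr_inv1E wr_inv2E.
  by rewrite /= invg1 perm1 ffunE.
by rewrite base_mul_GT ?groupV.
Qed.

Let base_capHT : base n N :&: HT = base n M.
Proof.
have [_ _ [_ DM _] _ _] := GHge.
have memM g : (g \in M) = (g \in N) && (g \in H) by rewrite -in_setI DM.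
apply/setP=> x; rewrite in_setI; apply/andP/mem_base => [[/mem_base[x2 xN]] | [x2 xM]].
  case/HT_GT=> /mem_wreath xH _; split=> // i.
  by rewrite memM xN xH.
split; first by apply/mem_base; split=> // i; have := xM i; rewrite memM => /andP[].
have xB : x \in base n M by apply/mem_base.
have [/andP[/subsetP sub _] _ _] := Htriple_wreath nMH irr_phi Dphit.
exact: sub.
Qed.

(* An element moving some coordinate centralises N^n only if N = 1. *)
Let cent_base x : x \in 'C_GT(base n N)%g ->
  (forall i, x.1 i \in 'C_G(N)%g) /\ (x.2 = 1%g \/ N :=: 1%g).
Proof.
case/setIP=> xGT /centP cx; have [xG _] := (stabHorbP _ _ _ p_pr).1 xGT.
have comm i j g : g \in N -> (x.1 j * (if x.2 j == i then g else 1) =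
    (if j == i then g else 1) * x.1 j)%g.
  move=> gN; have := cx _ (base_delta i gN).
  move/(congr1 (fun y : wreath_type gT n => y.1 j)).
  by rewrite !wr_mul1E /= perm1 !ffunE.
have [x2 | [i ne_i]] : x.2 = 1%g \/ exists i, x.2 i != i.
  have [/forallP fix_x | /forallPn[i ne_i]] := boolP [forall i, x.2 i == i];
    last by right; exists i.
  by left; apply/permP=> i; rewrite perm1; apply/eqP.
  split; last by left.
  move=> i; rewrite in_setI (mem_wreath _ _ xG); apply/centP=> g gN.
  by have := comm i i g gN; rewrite x2 perm1 eqxx.
(* At a moved coordinate [i], commuting with [g] placed there reads [x.1 i = g * x.1 i]. *)
have N1 : N :=: 1%g.
  apply/trivgP/subsetP=> g gN; rewrite inE; have := comm i i g gN.
  rewrite eqxx (negPf ne_i) mulg1 => /esym/eqP; rewrite -{2}[x.1 i]mul1g.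
  by rewrite (inj_eq (mulIg _)).
split; last by right.
by move=> j; rewrite in_setI (mem_wreath _ _ xG) N1 cent1T inE.
Qed.

Let inertia_GT y : y \in 'I_GT[thetat]%g ->
  forall i, y.1 i \in 'I_G[theta]%g /\ b (y.2 i) = b i.
Proof.
case/setIP=> yGT yI i; have [yG _] := (stabHorbP _ _ _ p_pr).1 yGT.
by have [] := inertia_blocks nNG irr_theta Dthetat nonconj i yG (inertiaJ yI).
Qed.

Let inertia_HT y : y \in 'I_HT[phit]%g ->
  y \in 'I_GT[thetat]%g /\ forall i, y.1 i \in 'I_H[phi]%g /\ b (y.2 i) = b i.
Proof.
case/setIP=> yHT yI; have [yH yGT] := (HT_GT y).1 yHT.
have stab_y : cfGal y idfun thetat = thetat.
  apply/same_stab_wreath => //; first exact: inH_id.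
  by rewrite cfGal_id (inertiaJ yI).
have yIG : y \in 'I_GT[thetat]%g.
  rewrite in_setI yGT inE -{1}cfGal_id stab_y eqxx andbT.
  apply: wreath_norm_base; apply/mem_wreath=> i.
  exact/(subsetP (normal_norm nNG))/(mem_wreath _ _ (wreath_sub yH)).
split=> // i; have [/setIP[_ yiI] eq_b] := inertia_GT yIG i.
by split; rewrite // -IHE in_setI (mem_wreath _ _ yH).
Qed.

Let base_IGT y : y \in base n N -> y \in 'I_GT[thetat]%g.
Proof.
move=> yN; rewrite in_setI GT_mul (subsetP (sub_inertia _)) // andbT.
apply/mulsgP; exists y 1%g; rewrite ?mulg1 //.
have [/andP[/subsetP sub _] _ _] := Htriple_wreath nMH irr_phi Dphit.
exact/sub/group1.
Qed.

Let base_IHT y : y \in base n M -> y \in 'I_HT[phit]%g.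
Proof.
move=> yM; rewrite in_setI (subsetP (sub_inertia _)) // andbT.
by have [/andP[/subsetP-> //]] := Htriple_wreath nMH irr_phi Dphit.
Qed.

Section ProjPair.

Variables (d d' : nat) (P : gT -> 'M[algC]_d) (P' : gT -> 'M[algC]_d').
Variables alpha alpha' : gT -> gT -> algC.
Hypothesis PA : proj_assoc 'I_G[theta]%g theta P alpha.
Hypothesis PA' : proj_assoc 'I_H[phi]%g phi P' alpha'.
Hypothesis eq_alpha : {in 'I_H[theta]%g &, forall x y, alpha x y = alpha' x y}.
Hypothesis eq_mu : forall x u, x \in H -> inH p u -> cfGal x u theta = theta ->
  forall mu mu', mu_spec 'I_G[theta]%g N P x u mu -> mu_spec 'I_H[phi]%g M P' x u mu' ->
  {in 'I_H[theta]%g, mu =1 mu'}.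

(** A form of [eq_mu] free of [mu]: both functions exist by [mu_exists], and their equality provides
    the common scalar [c]. *)
Let intertwiner_pair x u : x \in H -> inH p u -> cfGal x u theta = theta ->
  exists AA : 'M[algC]_d * 'M[algC]_d', [/\ intertwines N P x u AA.1,
    intertwines M P' x u AA.2 & forall y, y \in 'I_H[phi]%g -> exists c,
      AA.1 *m map_mx u (P (x * y * x^-1)%g) = c *: (P y *m AA.1) /\
      AA.2 *m map_mx u (P' (x * y * x^-1)%g) = c *: (P' y *m AA.2)].
Proof.
move=> xH uH stab_x; have stab'_x := (same_stab xH uH).1 stab_x.
have nNx := subsetP (normal_norm nNG) x (sH xH).
have nMx := subsetP (normal_norm nMH) x xH.
have [A HA] := intertwiner_exists PA nNx stab_x.
have [A' HA'] := intertwiner_exists PA' nMx stab'_x.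
have [mu mu_s Dmu] := mu_exists irr_theta PA (normal_Inertia theta (normal_sub nNG)) nNx
  (norm_inertia_cfGal nNG (sH xH) stab_x) HA.
have [mu' mu'_s Dmu'] := mu_exists irr_phi PA' (normal_Inertia phi (normal_sub nMH)) nMx
  (norm_inertia_cfGal nMH xH stab'_x) HA'.
exists (A, A'); split=> // y yI; exists (mu y); rewrite Dmu ?sIHG //.
by rewrite Dmu' // (eq_mu xH uH stab_x mu_s mu'_s) // IHE.
Qed.

Let s i := sigma (b i).

Let wrP := wr_proj_assoc Dthetat PA (St := 'I_GT[thetat]%g)
  (fun y yI i => (inertia_GT yI i).1) (fun y yI i => congr1 sigma (inertia_GT yI i).2).

Let wrP' := wr_proj_assoc Dphit PA' (St := 'I_HT[phit]%g)
  (fun y yI i => ((inertia_HT yI).2 i).1)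
  (fun y yI i => congr1 sigma ((inertia_HT yI).2 i).2).

Lemma wr_mu_eq x u : x \in HT -> inH p u -> cfGal x u thetat = thetat ->
  forall mu mu', mu_spec 'I_GT[thetat]%g (base n N) (wr_repr s P) x u mu ->
    mu_spec 'I_HT[phit]%g (base n M) (wr_repr s P') x u mu' ->
  {in 'I_HT[phit]%g, mu =1 mu'}.
Proof.
move=> /HT_GT[xH xGT] uH stab_x mu mu' mu_s mu'_s y yI.
have [yIG yi] := inertia_HT yI; have xG := wreath_sub xH.
have xi i : x.1 i \in H := mem_wreath _ _ xH i.
pose tau := coord_aut b sigma x u.
have tauH i : inH p (tau i) by do !apply: inH_comp => //; apply: inH_inv.
have stab_i i : cfGal (x.1 i) (tau i) theta = theta.
  exact: (cfGal_wreath nNG irr_theta Dthetat u xG).1.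
have stab'_i i : cfGal (x.1 i) (tau i) phi = phi by apply/same_stab.
have /fin_all_exists[AA HAA] i := intertwiner_pair (xi i) (tauH i) (stab_i i).
(* Choosing a single coordinate per block makes the scalars relating
   different coordinates of the block agree for P and P'. *)
pose r i := odflt i [pick j | b j == b i].
have br i : b (r i) = b i.
  by rewrite /r; case: pickP => [j /eqP // | /(_ i)]; rewrite eqxx.
(* Only the default value in [r] could separate [i] from [j], and it is never reached since each
   block contains its own index. *)
have eq_r i j : b i = b j -> r i = r j.
  by rewrite /r => ->; case: pickP => // /(_ j); rewrite eqxx.
have tau_b i j : b i = b j -> tau i = tau j.
  exact: (stab_coord_aut nNG irr_theta Dthetat nonconj).
pose A i := shift_intertwiner P (tau i) (x.1 (r i)) (AA (r i)).1 (x.1 i).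
pose A' i := shift_intertwiner P' (tau i) (x.1 (r i)) (AA (r i)).2 (x.1 i).
have cosI i j : b i = b j -> (x.1 i * (x.1 j)^-1)%g \in 'I_H[phi]%g.
  move=> eq_b; apply: (coset_inertia nMH (xi i) (xi j) (stab'_i i)).
  by rewrite (tau_b i j eq_b).
have HA i : intertwines N P (x.1 i) (tau i) (A i).
  apply: (shift_intertwines PA);
    rewrite ?(subsetP (normal_norm nNG)) ?sH ?sIHG ?cosI //.
  by rewrite -(tau_b _ _ (br i)); case: (HAA (r i)).
have HA' i : intertwines M P' (x.1 i) (tau i) (A' i).
  apply: (shift_intertwines PA'); rewrite ?(subsetP (normal_norm nMH)) ?cosI //.
  by rewrite -(tau_b _ _ (br i)); case: (HAA (r i)).
have xyE l : exists c,
    A l *m map_mx (tau l) (P ((x * y * x^-1)%g.1 l)) =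
       c *: (P (y.1 (x.2 l)) *m A (x.2^-1%g (y.2 (x.2 l)))) /\
    A' l *m map_mx (tau l) (P' ((x * y * x^-1)%g.1 l)) =
       c *: (P' (y.1 (x.2 l)) *m A' (x.2^-1%g (y.2 (x.2 l)))).
  rewrite wr_conj1E; set z := y.1 (x.2 l); set l' := (x.2^-1)%g _.
  have zI : z \in 'I_H[phi]%g := (yi _).1.
  (* [x.2] carries [l'] and [l] to [y.2 (x.2 l)] and [x.2 l], which share a block; hence [A l] and
     [A l'] are translates of one intertwiner. *)
  have bl' : b l' = b l.
    apply/(stab_blocks nNG irr_theta Dthetat nonconj l' l xG stab_x).
    by rewrite permKV (yi _).2.
  have rl' : r l' = r l := eq_r _ _ bl'.
  have [_ _ /(_ z zI)[c]] := HAA (r l).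
  rewrite -/(tau _) (tau_b _ _ (br l)) => -[c1 c2].
  have I1 : (x.1 l * (x.1 (r l))^-1)%g \in 'I_H[phi]%g by rewrite cosI.
  have I2 : (x.1 l' * (x.1 (r l))^-1)%g \in 'I_H[phi]%g by rewrite cosI // br.
  have I3 : (x.1 (r l) * z * (x.1 (r l))^-1)%g \in 'I_H[phi]%g.
    by rewrite mem_conjV_norm // (norm_inertia_cfGal nMH (xi _) (stab'_i _)).
  have I4 : (x.1 l * z * (x.1 l')^-1)%g \in 'I_H[phi]%g.
    have -> : (x.1 l * z * (x.1 l')^-1 = x.1 l * (x.1 (r l))^-1 *
        (x.1 (r l) * z * (x.1 (r l))^-1) * (x.1 l' * (x.1 (r l))^-1)^-1)%g.
      by rewrite invMg invgK !mulgA !mulgKV.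
    by apply: groupM; [apply: groupM | rewrite groupV].
  (* By [I1] to [I4] all arguments of the factor sets lie in $H_\theta$, where [alpha] and [alpha']
     agree; so the scalars for [P] and [P'] coincide. *)
  have := shift_twist irr_theta PA (sIHG I1) (sIHG I2) (sIHG I3) (sIHG I4) c1.
  have := shift_twist irr_phi PA' I1 I2 I3 I4 c2.
  rewrite -!eq_alpha ?IHE // => e2 e1; rewrite /A /A' rl' (tau_b _ _ bl').
  exact: ex_intro (conj e1 e2).
have [c Hc] := fin_all_exists xyE.
have sy i : s (y.2 i) = s i by rewrite /s (yi i).2.
have s_tau l e : s (x.2 l) (tau l e) = u (s l e) by rewrite /s coord_autE.
have base_sub_GT : base n N \subset 'I_GT[thetat]%g.
  by apply/subsetP=> z; apply: base_IGT.
have base_sub_HT : base n M \subset 'I_HT[phit]%g.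
  by apply/subsetP=> z; apply: base_IHT.
rewrite (mu_unique (base_irr irr_theta Dthetat) wrP base_sub_GT mu_s
  (wr_intertwines s_tau HA) yIG (wr_twist s_tau sy (fun l => (Hc l).1))).
by rewrite (mu_unique (base_irr irr_phi Dphit) wrP' base_sub_HT mu'_s
  (wr_intertwines s_tau HA') yI (wr_twist s_tau sy (fun l => (Hc l).2))).
Qed.

End ProjPair.

Lemma ge_c_wreath : ge_c p GT thetat HT phit.
Proof.
have [_ _ [_ DM sCH] _ [d [d' [P [P' [alpha [alpha' [[PA PA'] [[QP QP'] [ra ra']]
  eq_alpha cent_scal eq_mu]]]]]]]] := GHge.
have IGT y yI i := (@inertia_GT y yI i).1.
have IGTs y yI i := congr1 sigma (@inertia_GT y yI i).2.
have IHT y yI i := ((@inertia_HT y yI).2 i).1.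
have IHTs y yI i := congr1 sigma ((@inertia_HT y yI).2 i).2.
(* The comparison clauses of [ge_c] range over the inertia group of [thetat] in [HT], while
   [wr_repr s P'] is controlled on that of [phit]. *)
have IHT_eq y : y \in 'I_HT[thetat]%g -> y \in 'I_HT[phit]%g.
  case/setIP=> yHT yI; have [yH _] := (HT_GT y).1 yHT.
  rewrite in_setI yHT inE.
  have -> : (phit ^ y)%CF = phit.
    rewrite -cfGal_id; apply/(same_stab_wreath yH (inH_id p)).
    by rewrite cfGal_id (inertiaJ yI).
  rewrite eqxx andbT; apply: wreath_norm_base; apply/mem_wreath=> i.
  exact/(subsetP (normal_norm nMH))/(mem_wreath _ _ yH).
have cent_HT c : c \in 'C_GT(base n N)%g -> c \in HT.
  move=> cC; have [cG _] := cent_base cC; apply/HT_GT; split; last by case/setIP: cC.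
  by apply/mem_wreath=> i; apply: (subsetP sCH).
split.
- by split; [apply: Htriple_wreath Dthetat | apply: Htriple_wreath Dphit].
- by apply/subsetP=> x /HT_GT[].
- by split; [apply: GT_mul | apply: base_capHT | apply/subsetP].
- by move=> h u /HT_GT[hH _] uH; apply: same_stab_wreath.
pose s i := sigma (b i).
exists #|{ffun 'I_n -> 'I_d}|, #|{ffun 'I_n -> 'I_d'}|, (wr_repr s P), (wr_repr s P').
exists (wr_factor_set s alpha), (wr_factor_set s alpha'); split.
- split; first exact: (wr_proj_assoc Dthetat PA IGT IGTs).
  exact: (wr_proj_assoc Dphit PA' IHT IHTs).
- split; split.
  + exact: (wr_entries_Qab _ IGT QP).
  + exact: (wr_entries_Qab _ IHT QP').
  + exact: (wr_root_factor_set _ IGT ra).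
  exact: (wr_root_factor_set _ IHT ra').
- move=> x y /IHT_eq xI /IHT_eq yI; apply: eq_bigr => i _.
  by rewrite eq_alpha ?IHE //; apply: IHT.
(* A nontrivial permutation forces [N], hence also its intersection [M] with [H], to be trivial;
   then [d] and [d'] are 1 and both operators are still scalar. *)
- move=> c cC; have [cG c2] := cent_base cC.
  have /fin_all_exists[lam Dlam] i := cent_scal _ (cG i).
  exists (\prod_i s i (lam i)); split.
    apply: wr_repr_scalar => [i|]; first exact: (Dlam i).1.
    case: c2 => [|N1]; [by left | right].
    exact: proj_assoc_trivial irr_theta PA N1.
  apply: wr_repr_scalar => [i|]; first exact: (Dlam i).2.
  case: c2 => [|N1]; [by left | right]; apply: proj_assoc_trivial irr_phi PA' _.
  by rewrite -DM N1 setI1g.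
move=> x u xHT uH stab_x mu mu' mu_s mu'_s y /IHT_eq yI.
exact: (wr_mu_eq PA PA' eq_alpha eq_mu xHT uH stab_x mu_s mu'_s yI).
Qed.

End WreathTriple.

(** * From products over consecutive blocks to products over coordinates *)

Lemma block_prod (gT : finGroupType) (N : {group gT}) (theta : 'CF(N)) (k m : nat)
    (sigma : 'I_k -> {rmorphism algC -> algC}) (b : 'I_(m * k) -> 'I_k)
    (x : wreath_type gT (m * k)) :
    (forall j, b j = (j %/ m)%N :> nat) ->
  \prod_(i < k) \prod_(j < m * k | (j %/ m)%N == i) cfAut (sigma i) theta (wr_fun x j) =
    \prod_j cfAut (sigma (b j)) theta (x.1 j).
Proof.
move=> Db; rewrite [RHS](partition_big b xpredT) //=; apply: eq_bigr => i _.
rewrite (eq_bigl (fun j => b j == i)) => [|j]; last by rewrite -val_eqE /= Db.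
by apply: eq_bigr => j /eqP->.
Qed.

Theorem theorem2p7 (p : nat) (gT : finGroupType)
    (G N H M : {group gT}) (theta : 'CF(N)) (phi : 'CF(M))
    (k m : nat) (sigma : 'I_k -> {rmorphism algC -> algC})
    (thetat : 'CF(base (m * k) N)) (phit : 'CF(base (m * k) M)) :
  prime p ->
  Htriple p G theta -> Htriple p H phi ->
  ge_c p G theta H phi ->
  (0 < k)%N -> (0 < m)%N ->
  (forall i, inH p (sigma i)) ->
  (forall i j : 'I_k, i != j ->
     ~ (exists2 g, g \in G & (cfAut (sigma i) theta ^ g)%CF = cfAut (sigma j) theta)) ->
  (* thetat = theta_1^m x ... x theta_k^m, phit = phi_1^m x ... x phi_k^m *)
  (forall x, x \in base (m * k) N ->
     thetat x = \prod_(i < k) \prod_(j < m * k | (j %/ m)%N == i)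
                   cfAut (sigma i) theta (wr_fun x j)) ->
  (forall x, x \in base (m * k) M ->
     phit x = \prod_(i < k) \prod_(j < m * k | (j %/ m)%N == i)
                 cfAut (sigma i) phi (wr_fun x j)) ->
  ge_c p (stabHorb p (wreath (m * k) G) thetat) thetat
         (stabHorb p (wreath (m * k) H) phit) phit.
Proof.
move=> p_pr _ _ GHge k0 m0 sigmaH nonconj Dthetat Dphit.
(* Coordinates are numbered from 0, and those from [i * m] to [i * m + m - 1] carry $\theta_i$, so
   the block is the quotient by [m]. *)
have b_lt (j : 'I_(m * k)) : (j %/ m < k)%N.
  by rewrite ltn_divLR // [X in (_ < X)%N]mulnC.
pose b j := Ordinal (b_lt j).
apply: (ge_c_wreath (b := b) p_pr GHge sigmaH) => [i j g gG Dg | x xN | x xM].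
- by apply/eqP/negPn/negP=> /nonconj[]; exists g.
- by rewrite Dthetat // (block_prod _ _ (b := b)).
by rewrite Dphit // (block_prod _ _ (b := b)).
Qed.
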